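(* For all $1\leq i\leq d$ there exist numbers $f(i,d)$ and $g(i,d)$ with the following property. Let $\mathcal{F}$ be a finite $(d+1)$-colored family of convex sets in $\mathbb{R}^d$ that satisfies $\mathcal{CH}(\mathcal{F}_1,\dots,\mathcal{F}_{d+1})$. Then there exist $k\in[d]$ and a relabeling of the color classes $\mathcal{F}_1,\dots,\mathcal{F}_{d+1}$ of $\mathcal{F}$ such that (1) $\bigcup_{1\leq j\leq k}\mathcal{F}_j$ can be pierced by $f(k,d)$ points, and (2) $\bigcup_{k<j\leq d+1}\mathcal{F}_j$ can be crossed by $g(k,d)$ $k$-flats.
   Context: A finite family $\mathcal{F}$ of convex sets is $m$-colored if each set is colored with (at least) one of $m$ colors; $\mathcal{F}=\mathcal{F}_1\cup\dots\cup\mathcal{F}_m$, where $\mathcal{F}_i$ is the class of sets with color $i$. The family has the Colorful Helly property $\mathcal{CH}(\mathcal{F}_1,\dots,\mathcal{F}_m)$ if every rainbow selection $K_i\in\mathcal{F}_i$, $1\le i\le m$, satisfies $\bigcap_{i=1}^m K_i\neq\emptyset$. A $k$-flat is a $k$-dimensional affine subspace of $\mathbb{R}^d$. A collection $X$ of points (resp. $k$-flats) pierces/crosses a family if every set of the family is intersected by some member of $X$.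
   Formalization: Every color class is assumed nonempty; with an empty class the colorful Helly property holds vacuously and the claim fails, e.g. d=2, F_1 empty, F_2 and F_3 large sets of one-point sets in general position. *)

(* Defs.v *)
From mathcomp Require Import all_boot all_order all_algebra all_fingroup.
From mathcomp Require Import boolp classical_sets cardinality reals convex.

Set Implicit Arguments.
Unset Strict Implicit.
Unset Printing Implicit Defensive.

Import Order.TTheory GRing.Theory Num.Theory.

Local Open Scope classical_set_scope.
Local Open Scope ring_scope.

Section Families.
Context {R : realType} {d : nat}.
Notation V := 'rV[R]_d.

Definition convex_family (F : set (set V)) : Prop :=
  forall K, F K -> convex_set K.

(* [C i] is the class of the sets with color [i]; the classes may overlap, a
   set being allowed several colors. *)
Definition colored (m : nat) (F : set (set V)) (C : 'I_m -> set (set V)) : Prop :=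
  F = \bigcup_i C i.

Definition colorful_helly (m : nat) (C : 'I_m -> set (set V)) : Prop :=
  forall K : 'I_m -> set V, (forall i, C i (K i)) -> \bigcap_i K i !=set0.

Definition flat (k : nat) (L : set V) : Prop :=
  exists (p : V) (U : {vspace V}), \dim U = k /\ L = [set p + u | u in [set` U]].

Definition pierces (X : set V) (F : set (set V)) : Prop :=
  forall K, F K -> exists2 x, X x & K x.

Definition crosses (X : set (set V)) (F : set (set V)) : Prop :=
  forall K, F K -> exists2 L, X L & K `&` L !=set0.

(* A family pierced (crossed) by [n] points (flats) is one pierced (crossed) by
   at most [n] of them: there is, for instance, only one [d]-flat. *)
Definition pierced_by_points (n : nat) (F : set (set V)) : Prop :=
  exists X : set V, (X #<= `I_n)%card /\ pierces X F.

Definition crossed_by_flats (n k : nat) (F : set (set V)) : Prop :=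
  exists X : set (set V),
    [/\ (X #<= `I_n)%card, (forall L, X L -> flat k L) & crosses X F].

End Families.

(* Main.v *)
(* Call a colour class bad if it cannot be pierced by few points. The key step:
   suppose that finitely many affine copies of R^e are given and every set g of a
   family G of convex sets meets every member of a class B inside one of them.
   If B is bad, then by the (p, q)-theorem for unions of convex sets in these
   copies it contains boundedly many sets such that no e+1 of them have a common
   point in any copy. By pigeonhole each g meets e+1 of them in a single copy;
   these e+1 sets lie in half-spaces without a common point, so g crosses one of
   the boundary hyperplanes. Hence G is crossed by boundedly many flats of
   dimension e-1.

   Applying this to the bad classes one at a time, with G the set of intersections
   of rainbow selections from the remaining classes, shows that if exactly d+1-k
   classes are bad then each of them, reached after using up the d-k others, is
   crossed by boundedly many k-flats; and d+1 classes cannot all be bad, since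
   crossing by 0-flats is piercing. *)
Require Import Defs.
From mathcomp Require Import all_boot all_order all_algebra all_fingroup.
From mathcomp Require Import boolp classical_sets cardinality reals convex.
From mathcomp Require Import interval_inference topology normedtype derive.
From mathcomp Require Import ring lra zify.

Set Implicit Arguments.
Unset Strict Implicit.
Unset Printing Implicit Defensive.

Import Order.TTheory GRing.Theory Num.Theory.
Import numFieldNormedType.Exports.

Local Open Scope classical_set_scope.
Local Open Scope ring_scope.

(** * Convex sets, Radon's and Helly's theorems *)

Lemma convex_setE (R : numDomainType) (V : lmodType R) (K : set V) :
  convex_set K <->
  forall x y (t : R), 0 <= t -> t <= 1 -> K x -> K y -> K (t *: x + (1 - t) *: y).
Proof.
split=> [cK x y t t0 t1 Kx Ky | cK x y t /set_mem Kx /set_mem Ky].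
  by have := cK x y (Itv01 t0 t1) (mem_set Kx) (mem_set Ky) => /set_mem.
by apply/mem_set; apply: cK.
Qed.

Lemma convex_comb (R : realFieldType) (V : lmodType R) (K : set V)
    (I : eqType) (r : seq I) (P : pred I) (l : I -> R) (x : I -> V) :
  convex_set K -> (forall i, P i -> 0 <= l i) ->
  (forall i, P i -> 0 < l i -> K (x i)) ->
  \sum_(i <- r | P i) l i = 1 -> K (\sum_(i <- r | P i) l i *: x i).
Proof.
move=> /convex_setE cK l0 Kx l1.
(* Dropping a term changes the total weight, so the induction runs over combinations of any positive
   weight [s], normalized by [s^-1]. *)
suff H : forall s : R, 0 < s -> \sum_(i <- r | P i) l i = s ->
    K (s^-1 *: \sum_(i <- r | P i) l i *: x i).
  by have := H 1 ltr01 l1; rewrite invr1 scale1r.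
elim: r {l1} => [|a r IH] s s0; first by rewrite big_nil => s1; rewrite s1 ltxx in s0.
rewrite !big_cons; case: ifP => Pa; last exact: IH.
set s' := \sum_(i <- r | P i) l i => ls.
have s'0 : 0 <= s' by apply: sumr_ge0.
have [s'E|s'n0] := eqVneq s' 0.
  have -> : \sum_(i <- r | P i) l i *: x i = 0.
    move/eqP: s'E; rewrite /s' psumr_eq0 // => /allP h.
    elim: r {IH s' s'0 ls} h => [|b r IH] h; first by rewrite big_nil.
    rewrite big_cons IH => [|i ir]; last by apply: h; rewrite inE ir orbT.
    have := h b (mem_head _ _); case: (P b) => //= /eqP ->.
    by rewrite scale0r addr0.
  rewrite addr0 scalerA; have <- : l a = s by rewrite -ls s'E addr0.
  have la : 0 < l a by move: s0; rewrite -ls s'E addr0.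
  by rewrite mulVf ?lt0r_neq0// scale1r; exact: Kx.
have s'gt : 0 < s' by rewrite lt_neqAle eq_sym s'n0.
have Ks' := IH s' s'gt erefl.
have [laE|lan0] := eqVneq (l a) 0.
  by rewrite laE scale0r add0r -ls laE add0r.
have la : 0 < l a by rewrite lt_neqAle eq_sym lan0 l0.
have := cK (x a) _ (s^-1 * l a) _ _ (Kx a Pa la) Ks'.
rewrite scalerA -ls.
have -> : (1 - (l a + s')^-1 * l a) / s' = (l a + s')^-1.
  by field; rewrite ls lt0r_neq0.
rewrite scalerDr scalerA; apply.
  by rewrite mulr_ge0// ?ltW// ls invr_gt0.
by rewrite mulrC ls ler_pdivrMr// mul1r -ls lerDl.
Qed.

Lemma convex_bigcap (R : numDomainType) (V : lmodType R) (I : Type)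
    (D : set I) (A : I -> set V) :
  (forall i, D i -> convex_set (A i)) -> convex_set (\bigcap_(i in D) A i).
Proof.
move=> cA; apply/convex_setE => x y t t0 t1 Ax Ay i Di.
by have /convex_setE := cA i Di; apply=> //; [exact: Ax | exact: Ay].
Qed.

Definition hull (R : numDomainType) (V : lmodType R) (A : set V) : set V :=
  [set z | forall K, convex_set K -> A `<=` K -> K z].

Lemma convex_hull (R : numDomainType) (V : lmodType R) (A : set V) :
  convex_set (hull A).
Proof.
apply/convex_setE => x y t t0 t1 hx hy K cK AK.
by move: (cK) => /convex_setE; apply=> //; [exact: hx | exact: hy].
Qed.

Lemma sub_hull (R : numDomainType) (V : lmodType R) (A : set V) : A `<=` hull A.
Proof. by move=> x Ax K _; apply. Qed.

Lemma hull_sub (R : numDomainType) (V : lmodType R) (A K : set V) :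
  convex_set K -> A `<=` K -> hull A `<=` K.
Proof. by move=> cK AK z; apply. Qed.

Lemma hull_mono (R : numDomainType) (V : lmodType R) (A B : set V) :
  A `<=` B -> hull A `<=` hull B.
Proof.
by move=> AB; apply: hull_sub; [exact: convex_hull | exact: subset_trans (@sub_hull _ _ B)].
Qed.

(** A nontrivial affine dependence exists because the matrix [X] of the points, with a column of
    ones, has more rows than columns. The indices with positive coefficient and the remaining ones
    then give equal weighted means. *)
Lemma radon (R : realFieldType) (e : nat) (y : 'I_e.+2 -> 'rV[R]_e) :
  exists (S : {set 'I_e.+2}) (z : 'rV[R]_e),
    hull [set y i | i in [set i | i \in S]] z /\
    hull [set y i | i in [set i | i \notin S]] z.
Proof.
pose X : 'M[R]_(e.+2, e + 1) := row_mx (\matrix_i y i) (const_mx 1).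
have /rowV0Pn[mu] : kermx X != 0.
  rewrite kermx_eq0 /row_free; apply/negP => /eqP rX.
  by have := rank_leq_col X; rewrite rX addn1 ltnn.
rewrite sub_kermx mul_mx_row => /eqP muX mu0.
have [/rowP muY /rowP muS] : mu *m (\matrix_i y i) = 0 /\ mu *m (const_mx 1 : 'cV_e.+2) = 0.
  by apply/eq_row_mx; rewrite muX row_mx0.
pose m i := mu 0 i.
have Sm : \sum_i m i = 0.
  have := muS 0; rewrite !mxE => muS0; rewrite -[RHS]muS0.
  by apply: eq_bigr => i _; rewrite mxE mulr1.
have Ym : \sum_i m i *: y i = 0.
  apply/rowP => j; have := muY j; rewrite !mxE => muYj; rewrite -[RHS]muYj.
  by rewrite summxE; apply: eq_bigr => i _; rewrite !mxE.
pose S := [set i | 0 < m i]%SET.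
pose s := \sum_(i | 0 < m i) m i.
have sE : \sum_(i | ~~ (0 < m i)) - m i = s.
  move: Sm; rewrite (bigID (fun i => 0 < m i)) /= => /eqP.
  by rewrite addr_eq0 => /eqP; rewrite sumrN.
have zE : \sum_(i | ~~ (0 < m i)) - m i *: y i = \sum_(i | 0 < m i) m i *: y i.
  move: Ym; rewrite (bigID (fun i => 0 < m i)) /= => /eqP.
  rewrite addr_eq0 => /eqP ->; rewrite -sumrN.
  by apply: eq_bigr => i _; rewrite scaleNr.
have s0 : 0 < s.
  rewrite lt_neqAle sumr_ge0 ?andbT => [|i /ltW //].
  apply/negP => /eqP sz; case/negP: mu0; apply/eqP/rowP => i; rewrite [RHS]mxE.
  case: (ltP 0 (m i)) => mi.
    have /eqP := esym sz; rewrite psumr_eq0 => [|j /ltW //].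
    by move/allP/(_ i (mem_index_enum _)); rewrite mi => /eqP.
  have /eqP := sE; rewrite -sz psumr_eq0 => [|j]; last first.
    by rewrite -leNgt oppr_ge0.
  by move/allP/(_ i (mem_index_enum _)); rewrite -leNgt mi oppr_eq0 => /eqP.
exists S, (s^-1 *: \sum_(i | 0 < m i) m i *: y i); split=> K cK SK.
  rewrite scaler_sumr; under eq_bigr do rewrite scalerA.
  apply: (convex_comb cK).
  - by move=> i /ltW mi; rewrite mulr_ge0// invr_ge0 ltW.
  - by move=> i mi _; apply: SK; exists i => //=; rewrite inE.
  - by rewrite -mulr_sumr mulVf ?lt0r_neq0.
rewrite -zE scaler_sumr; under eq_bigr do rewrite scalerA.
apply: (convex_comb cK).
- by move=> i; rewrite -leNgt => mi; rewrite mulr_ge0 ?oppr_ge0// invr_ge0 ltW.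
- by move=> i mi _; apply: SK; exists i => //=; rewrite inE.
- by rewrite -mulr_sumr sE mulVf ?lt0r_neq0.
Qed.

(** The point [y j] lies in every set but the [j]-th, so each side of a Radon partition of these
    points lies in the sets indexed by the other side, and the Radon point lies in all. *)
Lemma helly_critical (R : realFieldType) (e : nat) (K : 'I_e.+2 -> set 'rV[R]_e) :
  (forall i, convex_set (K i)) ->
  (forall j, \bigcap_(i in [set i | i != j]) K i !=set0) ->
  \bigcap_i K i !=set0.
Proof.
move=> cK /choice[y yK].
have [S [z [z1 z2]]] := radon y.
exists z => i _; case: (boolP (i \in S)) => iS.
  apply: z2 => // _ [j /= jS <-]; apply: yK => /=.
  by apply: contraNneq jS => <-.
apply: z1 => // _ [j /= jS <-]; apply: yK => /=.
by apply: contraNneq iS => ->.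
Qed.

(** * Polytopes and points of minimal norm *)

Definition dot (R : pzRingType) (n : nat) (x y : 'rV[R]_n) : R :=
  \sum_i x 0 i * y 0 i.

Lemma dotC (R : comPzRingType) n (x y : 'rV[R]_n) : dot x y = dot y x.
Proof. by apply: eq_bigr => i _; rewrite mulrC. Qed.

Lemma dotDl (R : pzRingType) n (x y z : 'rV[R]_n) :
  dot (x + y) z = dot x z + dot y z.
Proof. by rewrite -big_split; apply: eq_bigr => i _; rewrite mxE mulrDl. Qed.

Lemma dotZl (R : pzRingType) n (c : R) (x z : 'rV[R]_n) :
  dot (c *: x) z = c * dot x z.
Proof. by rewrite mulr_sumr; apply: eq_bigr => i _; rewrite mxE mulrA. Qed.

Lemma dotDr (R : comPzRingType) n (x y z : 'rV[R]_n) :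
  dot z (x + y) = dot z x + dot z y.
Proof. by rewrite !(dotC z) dotDl. Qed.

Lemma dotZr (R : comPzRingType) n (c : R) (x z : 'rV[R]_n) :
  dot z (c *: x) = c * dot z x.
Proof. by rewrite !(dotC z) dotZl. Qed.

Lemma dot0l (R : pzRingType) n (x : 'rV[R]_n) : dot 0 x = 0.
Proof. by apply: big1 => i _; rewrite mxE mul0r. Qed.

Lemma dot_ge0 (R : realDomainType) n (x : 'rV[R]_n) : 0 <= dot x x.
Proof. by apply: sumr_ge0 => i _; rewrite -expr2 sqr_ge0. Qed.

Lemma dot_eq0 (R : realDomainType) n (x : 'rV[R]_n) : dot x x = 0 -> x = 0.
Proof.
move=> /eqP; rewrite psumr_eq0 => [/allP h|i _]; last by rewrite -expr2 sqr_ge0.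
apply/rowP => i; have := h i (mem_index_enum _); rewrite mxE /= -expr2.
by rewrite sqrf_eq0 => /eqP.
Qed.

Lemma dot_continuous (R : realType) n : continuous (fun x : 'rV[R]_n => dot x x).
Proof.
apply: continuous_big => [|i _ x]; first exact: add_continuous.
have cx := @coord_continuous R 1 n 0 i x.
exact: (cvgM cx cx).
Qed.

Lemma closed_argmin (R : realType) n (A : set 'rV[R]_n) :
  closed A -> A !=set0 -> exists2 x, A x & forall y, A y -> dot x x <= dot y y.
Proof.
move=> cA [x0 Ax0]; pose q := dot x0 x0.
pose B := A `&` [set x | dot x x <= q].
have cB : closed B.
  apply: closedI => //.
  have /continuous_closedP dc := @dot_continuous R n.
  exact: (dc [set y | y <= q] (@closed_le _ q)).
have kB : compact B.
  apply: (subclosed_compact cB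
    (@rV_compact R n (fun=> `[- (1 + q), 1 + q]%classic)
      (fun=> @segment_compact _ _ _))) => x [_ /= xq] i /=.
  rewrite in_itv /= -ler_norml.
  have : `|x 0 i| ^+ 2 <= q.
    apply: le_trans xq; rewrite real_normK ?num_real// /dot (bigD1 i) //= expr2.
    by rewrite lerDl sumr_ge0 // => j _; rewrite -expr2 sqr_ge0.
  have := normr_ge0 (x 0 i); nra.
have [|x /set_mem [Ax xq] xmin] := EVT_min_rV _ kB (continuous_subspaceT (@dot_continuous R n)).
  by exists x0; split => //=.
exists x => // y Ay; case: (leP (dot y y) q) => [yq|/ltW yq].
  by apply: xmin; apply/mem_set; split.
exact: le_trans yq.
Qed.

Lemma convex_lt_dot (R : realFieldType) n (c : R) :
  convex_set [set x : 'rV[R]_n | dot x x < c].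
Proof.
apply/convex_setE => x y t t0 t1 /= xc yc.
(* This is the weighted mean of the two squared norms minus the squared norm of the weighted
   mean. *)
have h : 0 <= t * (1 - t) * dot (x + (-1) *: y) (x + (-1) *: y).
  by rewrite mulr_ge0 ?dot_ge0// mulr_ge0// subr_ge0.
move: h; rewrite !(dotDl, dotDr, dotZl, dotZr) (dotC y x) => h.
have [t'|t'] : t * dot x x < t * c \/ (1 - t) * dot y y < (1 - t) * c.
  have [->|tn] := eqVneq t 0; first by right; rewrite subr0 !mul1r.
  by left; rewrite ltr_pM2l// lt_neqAle eq_sym tn.
- have : (1 - t) * dot y y <= (1 - t) * c by rewrite ler_wpM2l ?subr_ge0// ltW.
  by nra.
- have : t * dot x x <= t * c by rewrite ler_wpM2l// ltW.
  by nra.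
Qed.

(** By the parallelogram law the midpoint of two distinct points of least norm would be shorter. *)
Lemma convex_argmin_unique (R : realFieldType) n (A : set 'rV[R]_n) x y :
  convex_set A -> A x -> A y -> (forall z, A z -> dot x x <= dot z z) ->
  dot y y <= dot x x -> y = x.
Proof.
move=> /convex_setE cA Ax Ay xmin yx.
have half0 : 0 <= 2^-1 :> R by lra.
have half1 : 2^-1 <= 1 :> R by lra.
have := xmin _ (cA x y 2^-1 half0 half1 Ax Ay).
rewrite !(dotDl, dotDr, dotZl, dotZr) (dotC y x) => h.
have : dot (y + (-1) *: x) (y + (-1) *: x) = 0.
  apply/eqP; rewrite eq_le dot_ge0 andbT.
  rewrite !(dotDl, dotDr, dotZl, dotZr) (dotC y x).
  by move: h yx; set a := dot x x; set b := dot y y; set c := dot x y; lra.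
by move/dot_eq0; rewrite scaleN1r => /eqP; rewrite subr_eq0 => /eqP.
Qed.

(** Variational inequality for the projection of the origin: if it failed, a small move from [x]
    towards [y] would shorten [x]. *)
Lemma convex_argmin_dot (R : realFieldType) n (A : set 'rV[R]_n) x y :
  convex_set A -> A x -> A y -> (forall z, A z -> dot x x <= dot z z) ->
  dot x x <= dot x y.
Proof.
move=> /convex_setE cA Ax Ay xmin; rewrite leNgt; apply/negP => xy.
pose D := dot y y - 2 * dot x y + dot x x.
have D0 : 0 <= D.
  have := dot_ge0 (y + (-1) *: x); rewrite !(dotDl, dotDr, dotZl, dotZr) (dotC y x).
  by rewrite /D; lra.
pose d := dot x x - dot x y; have d0 : 0 < d by rewrite /d; lra.
(* As [D] is the squared distance of [x] and [y], moving by [t] changes the squared norm by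
   [t ^ 2 * D - 2 * t * d], negative for this [t]. *)
pose t := d / (d + D).
have dD : 0 < d + D by lra.
have t0 : 0 < t by rewrite divr_gt0.
have t1 : t <= 1 by rewrite ler_pdivrMr//; lra.
have tD : t * (d + D) = d by rewrite divfK// lt0r_neq0.
have := xmin _ (cA y x t (ltW t0) t1 Ay Ax).
rewrite !(dotDl, dotDr, dotZl, dotZr) (dotC y x) leNgt => /negP; apply.
have : t * (t * (d + D)) = t * d by rewrite tD.
have : 0 < t * d by rewrite mulr_gt0.
have : 0 < t * t * d by apply: mulr_gt0 => //; exact: mulr_gt0.
move: tD; clearbody t => tD; rewrite /d /D.
move: (dot x x) (dot y y) (dot x y) => a b c; lra.
Qed.

(** The hull is the continuous image of the compact simplex of weights. *)
Lemma hull_finite_compact (R : realType) n (I : finType) (x : I -> 'rV[R]_n) :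
  compact (hull (range x)).
Proof.
pose m := #|I|; pose X (j : 'I_m) := x (enum_val j).
pose S := [set l : 'rV[R]_m | (forall j, l 0 j \in `[0, 1]%R) /\ \sum_j l 0 j = 1].
pose f (l : 'rV[R]_m) := \sum_j l 0 j *: X j.
have kS : compact S.
  have -> : S = [set l : 'rV[R]_m | forall j, `[0, 1]%classic (l 0 j)] `&`
                [set l | \sum_j l 0 j = 1].
    by apply/seteqP; split => l [].
  apply: compact_closedI.
    by apply: (@rV_compact R m (fun=> `[0, 1]%classic)) => _; exact: segment_compact.
  have /continuous_closedP : continuous (fun l : 'rV[R]_m => \sum_j l 0 j).
    apply: continuous_big => [|i _]; first exact: add_continuous.
    exact: coord_continuous.
  by move=> sc; exact: (sc [set 1] (@closed_eq _ 1)).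
suff -> : hull (range x) = f @` S.
  apply: continuous_compact => //; apply: continuous_subspaceT.
  apply: continuous_big => [|i _ l]; first exact: add_continuous.
  have cl := @coord_continuous R 1 m 0 i l.
  exact: (@cvgZr_tmp _ _ _ _ _ _ _ (X i) cl).
apply/seteqP; split.
  apply: hull_sub.
    apply/convex_setE => _ _ t t0 t1 [l [l0 l1] <-] [k [k0 k1] <-].
    exists (t *: l + (1 - t) *: k).
      split=> [j|].
        move: (l0 j) (k0 j); rewrite !in_itv /= !mxE => /andP[? ?] /andP[? ?].
        by apply/andP; split; nra.
      under eq_bigr do rewrite !mxE.
      by rewrite big_split /= -!mulr_sumr l1 k1; lra.
    rewrite /f !scaler_sumr -big_split /=; apply: eq_bigr => j _.
    by rewrite !mxE !scalerA -scalerDl.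
  move=> _ [i _ <-]; exists (delta_mx 0 (enum_rank i)).
    split=> [j|].
      by rewrite mxE in_itv /= ler0n lern1 leq_b1.
    rewrite (bigD1 (enum_rank i)) //= mxE !eqxx big1 ?addr0// => j ji.
    by rewrite mxE (negPf ji) andbF.
  rewrite /f (bigD1 (enum_rank i)) //= mxE !eqxx scale1r big1 => [|j ji].
    by rewrite addr0 /X enum_rankK.
  by rewrite mxE (negPf ji) andbF scale0r.
move=> _ [l [l0 l1] <-]; apply: convex_comb => //.
- exact: convex_hull.
- by move=> j _; have := l0 j; rewrite in_itv => /andP[].
- by move=> j _ _; apply: sub_hull; exists (enum_val j).
Qed.

Lemma hull_finite_closed (R : realType) n (I : finType) (x : I -> 'rV[R]_n) :
  closed (hull (range x)).
Proof.
by apply: compact_closed; [exact: norm_hausdorff | exact: hull_finite_compact].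
Qed.

(** Choose a common point for every intersecting subfamily and replace [K i] by the polytope of the
    points chosen for subfamilies containing [i]. The intersection pattern survives, and points of
    least norm become available. *)
Lemma closed_shrinking (R : realType) n (I : finType) (K : I -> set 'rV[R]_n) :
  (forall i, convex_set (K i)) ->
  exists K' : I -> set 'rV[R]_n, forall i, [/\ convex_set (K' i), closed (K' i),
    K' i `<=` K i & forall S : {set I}, i \in S ->
      \bigcap_(i in [set i | i \in S]) K i !=set0 ->
      \bigcap_(i in [set i | i \in S]) K' i !=set0].
Proof.
move=> cK.
have /choice[p pK] : forall S : {set I}, exists x,
    \bigcap_(i in [set i | i \in S]) K i !=set0 ->
    (\bigcap_(i in [set i | i \in S]) K i) x.
  move=> S; have [[x Kx]|no] := pselect (\bigcap_(i in [set i | i \in S]) K i !=set0).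
    by exists x.
  by exists 0 => /no.
pose good (S : {set I}) := `[< \bigcap_(i in [set i | i \in S]) K i !=set0 >].
pose D i := {S : {set I} | (i \in S) && good S}.
exists (fun i => hull (range (fun S : D i => p (val S)))) => i; split.
- exact: convex_hull.
- exact: hull_finite_closed.
- apply: hull_sub => // _ [[S /= /andP[iS /asboolP gS]] _ <-].
  exact: pK gS i iS.
- move=> S iS gS; exists (p S) => j /= jS.
  have h : (j \in S) && good S by rewrite jS; apply/asboolP.
  by apply: sub_hull; exists (Sub S h).
Qed.

(** * Fractional Helly theorem *)

(* [phi] picks the point of least norm. If it never worked, the e+1 sets together
   with the ball of points of smaller norm than their own least-norm point would
   contradict Helly's theorem. *)
Lemma helly_selection (R : realType) e (I : finType) (K : I -> set 'rV[R]_e) :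
  (forall i, convex_set (K i)) -> (forall i, closed (K i)) ->
  exists phi : {ffun 'I_e -> I} -> 'rV[R]_e,
    forall t : {ffun 'I_e.+1 -> I}, \bigcap_j K (t j) !=set0 ->
      exists j, K (t j) (phi [ffun i => t (lift j i)]).
Proof.
move=> cK kK.
have /choice[phi phiP] : forall u : {ffun 'I_e -> I}, exists x, \bigcap_j K (u j) !=set0 ->
    (\bigcap_j K (u j)) x /\ forall y, (\bigcap_j K (u j)) y -> dot x x <= dot y y.
  move=> u; have [ne|no] := pselect (\bigcap_j K (u j) !=set0); last by exists 0 => /no.
  have [|x Kx xmin] := closed_argmin _ ne; last by exists x.
  exact: closed_bigI.
exists phi => t ne; apply: contrapT => no.
have [|x Kx xmin] := closed_argmin _ ne; first exact: closed_bigI.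
pose u j : {ffun 'I_e -> I} := [ffun i => t (lift j i)].
have Kux j : (\bigcap_i K (u j i)) x by move=> i _; rewrite ffunE; exact: Kx.
have uP j : (\bigcap_i K (u j i)) (phi (u j)) /\ dot (phi (u j)) (phi (u j)) < dot x x.
  have [Ku umin] : _ := phiP (u j) (ex_intro _ x (Kux j)); split => //.
  (* Otherwise [x], which lies in the larger intersection, would also be of least norm there, hence
     equal to [phi (u j)], which would then lie in [K (t j)]. *)
  rewrite ltNge; apply/negP => xu; apply: no; exists j.
  rewrite -(convex_argmin_unique _ Ku (Kux j) umin xu); first exact: Kx.
  exact: convex_bigcap.
pose L := [set y : 'rV[R]_e | dot y y < dot x x].
pose K' (i : 'I_e.+2) := if unlift ord_max i is Some j then K (t j) else L.
have [||z zK'] := @helly_critical R e K'.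
- by move=> i; rewrite /K'; case: unlift => // ; exact: convex_lt_dot.
- move=> i; case: (unliftP ord_max i) => [j ->|->].
    exists (phi (u j)) => k /= /eqP kj; have [Kj xj] := uP j.
    rewrite /K'; case: unliftP => [j' kE|_] //.
    have [i' _ Ej'] : exists2 i', true & j' = lift j i'.
      case: (unliftP j j') => [i' ->|jj']; first by exists i'.
      by case: kj; rewrite kE jj'.
    by have := Kj i' Logic.I; rewrite ffunE -Ej'.
  exists x => k /= km; rewrite /K'; case: unliftP => [j' _|kE]; first exact: Kx.
  by rewrite kE eqxx in km.
have : dot x x <= dot z z.
  by apply: xmin => j _; have := zK' (lift ord_max j) Logic.I; rewrite /K' liftK.
by rewrite leNgt => /negP; apply; have := zK' ord_max Logic.I; rewrite /K' unlift_none.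
Qed.

Lemma card_sum_fibers (S T : finType) (P : S -> T -> bool) :
  #|[pred p : S * T | P p.1 p.2]| = (\sum_s #|[pred t | P s t]|)%N.
Proof.
rewrite -sum1_card; under [RHS]eq_bigr do rewrite -sum1_card.
by rewrite pair_big_dep.
Qed.

Lemma exists_ge_average (T : finType) (f : T -> nat) N :
  (0 < N)%N -> (N <= \sum_t f t)%N -> exists t, (N <= #|T| * f t)%N.
Proof.
move=> N0 Nf; apply: contrapT => /forallNP no.
have : (#|T| * \sum_t f t <= \sum_(t : T) N.-1)%N.
  rewrite big_distrr /=; apply: leq_sum => t _.
  by rewrite -ltnS prednK// ltnNge; apply/negP; exact: no.
rewrite sum_nat_const leq_mul2l; have [T0 _|T0] /= := eqVneq #|T| 0%N.
  move: Nf; rewrite big1 => [|t _]; first by rewrite leqNgt N0.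
  by move/card0_eq: T0 => /(_ t).
by rewrite leqNgt (leq_trans _ Nf) ?prednK.
Qed.

Lemma card_union_bound (S T : finType) (P : pred S) (Q : T -> pred S) :
  (forall s, P s -> exists t, Q t s) -> (#|P| <= \sum_t #|Q t|)%N.
Proof.
move=> PQ; rewrite -sum1_card big_mkcond /=.
under [X in (_ <= X)%N]eq_bigr => t _ do rewrite -sum1_card big_mkcond /=.
rewrite exchange_big /=; apply: leq_sum => s _; case: ifP => // /PQ[t Qt].
by rewrite (bigD1 t) //= -topredE /= Qt.
Qed.

Lemma pigeonhole_card (S T : finType) (P : pred S) (Q : T -> pred S) :
  (0 < #|P|)%N -> (forall s, P s -> exists t, Q t s) ->
  exists t, (#|P| <= #|T| * #|Q t|)%N.
Proof. by move=> P0 /card_union_bound; exact: exists_ge_average. Qed.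

(** Tuples may repeat indices. Every intersecting tuple has a position whose set contains the point
    selected from the other [e]; averaging first over the position and then over the [e]-tuples
    leaves one selected point in many sets. *)
Lemma fractional_helly (R : realType) e (I : finType) (K : I -> set 'rV[R]_e) A :
  (forall i, convex_set (K i)) -> (0 < #|I|)%N ->
  (#|I| ^ e.+1 <=
    A * #|[pred t : {ffun 'I_e.+1 -> I} | `[< \bigcap_j K (t j) !=set0 >]]|)%N ->
  exists x, (#|I| <= A * e.+1 * #|[pred i | `[< K i x >]]|)%N.
Proof.
move=> cK n0 nA.
have [K' K'P] := closed_shrinking cK.
have [||phi phiP] := @helly_selection R e I K'.
- by move=> i; case: (K'P i).
- by move=> i; case: (K'P i).
pose P j (t : {ffun 'I_e.+1 -> I}) := `[< K' (t j) (phi [ffun i => t (lift j i)]) >].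
have tP (t : {ffun 'I_e.+1 -> I}) : `[< \bigcap_j K (t j) !=set0 >] -> exists j, P j t.
  move=> /asboolP[x Kx].
  have [|j Kj] := phiP t; last by exists j; apply/asboolP.
  pose S := finset.imset t (mem 'I_e.+1); have tS j : t j \in S by exact: imset_f.
  have [_ _ _ /(_ S (tS ord0))[|y Ky]] := K'P (t ord0).
    by exists x => i /= /imsetP[j _ ->]; exact: Kx.
  by exists y => j _; exact: Ky (tS j).
have good0 : (0 < #|[pred t : {ffun 'I_e.+1 -> I} | `[< \bigcap_j K (t j) !=set0 >]]|)%N.
  rewrite lt0n; apply/eqP => g0; move: nA; rewrite g0 muln0 leqn0.
  by rewrite expn_eq0 eqn0Ngt n0.
have [j jP] := pigeonhole_card good0 tP.
have pairs : (#|P j| <= \sum_(u : {ffun 'I_e -> I}) #|[pred i | `[< K' i (phi u) >]]|)%N.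
  rewrite -card_sum_fibers.
  pose f (t : {ffun 'I_e.+1 -> I}) := ([ffun i => t (lift j i)] : {ffun 'I_e -> I}, t j).
  have f_inj : injective f.
    move=> s t [/ffunP st stj]; apply/ffunP => k.
    by case: (unliftP j k) => [i ->|->] //; have := st i; rewrite !ffunE.
  rewrite -(card_imset _ f_inj); apply: subset_leq_card.
  by apply/fintype.subsetP => _ /imsetP[t + ->]; rewrite !inE.
have [|u uP] := exists_ge_average _ pairs.
  by rewrite lt0n; apply/eqP => p0; move: jP; rewrite p0 muln0 leqNgt good0.
exists (phi u).
rewrite -(leq_pmul2l (m := (#|I| ^ e)%N)) ?expn_gt0 ?n0// -expnSr.
apply: leq_trans nA _; rewrite mulnCA -mulnA leq_mul2l; apply/orP; right.
apply: leq_trans jP _; rewrite card_ord leq_mul2l; apply/orP; right.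
apply: leq_trans uP _; rewrite card_ffun card_ord leq_mul2l; apply/orP; right.
apply: subset_leq_card; apply/fintype.subsetP => i; rewrite !inE => Ki.
by case: (K'P i) => _ _ sub _; exact: sub.
Qed.

(** * Weak epsilon-nets *)

(** Induction on [r] with [e + 2] blocks: by a Radon partition of the common points of the blocks,
    those in [S] supply the classes up to [r] and the others class [r + 1]. The number of points is
    exponential in [r], hence weak. *)
Lemma weak_tverberg (R : realFieldType) e r : exists T : finType,
  forall y : T -> 'rV[R]_e, exists (c : T -> nat) (z : 'rV[R]_e),
    forall a, (a <= r)%N -> hull [set y i | i in [set i | c i = a]] z.
Proof.
elim: r => [|r [T IH]].
  exists unit => y; exists (fun=> 0%N), (y tt) => a; rewrite leqn0 => /eqP ->.
  by apply: sub_hull; exists tt.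
exists ('I_e.+2 * T)%type => y.
have /choice[c /choice[z cz]] := fun j => IH (fun i => y (j, i)).
have [S [p [pS pCS]]] := radon z.
exists (fun ji => if ji.1 \in S then c ji.1 ji.2 else r.+1 + c ji.1 ji.2)%N, p => a.
rewrite leq_eqVlt ltnS => /orP[/eqP -> | ar].
  move: p pCS {pS}; apply: hull_sub; first exact: convex_hull.
  move=> _ [j /= jS <-]; apply: hull_mono (cz j 0%N isT) => _ [i /= ci <-].
  by exists (j, i) => //=; rewrite (negPf jS) ci addn0.
move: p pS {pCS}; apply: hull_sub; first exact: convex_hull.
move=> _ [j /= jS <-]; apply: hull_mono (cz j a ar) => _ [i /= ci <-].
by exists (j, i) => //=; rewrite jS.
Qed.

(** A tuple on [Y] is its restriction along [J] together with free values off the image of [J]. *)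
Lemma card_precomp_inj (X Y I : finType) (J : X -> Y) (P : pred {ffun X -> I}) :
  injective J ->
  #|[pred t : {ffun Y -> I} | P [ffun x => t (J x)]]| =
    (#|P| * #|I| ^ (#|Y| - #|X|))%N.
Proof.
move=> Jinj; rewrite -sum1_card.
rewrite (partition_big (fun t : {ffun Y -> I} => [ffun x => t (J x)]) P) //=.
rewrite -sum_nat_const; apply: eq_bigr => s Ps.
pose F y : pred I := if [pick x | J x == y] is Some x then pred1 (s x) else predT.
have FE (t : {ffun Y -> I}) :
    P [ffun x => t (J x)] && ([ffun x => t (J x)] == s) = (t \in family F).
  apply/andP/familyP => [[_ /eqP/ffunP ts] y|tF].
    rewrite /F; case: pickP => [x /eqP <-|//].
    by have := ts x; rewrite ffunE => ->; rewrite inE.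
  suff ts : [ffun x => t (J x)] = s by rewrite ts.
  apply/ffunP => x; rewrite ffunE; have := tF (J x); rewrite /F.
  by case: pickP => [x' /eqP/Jinj -> /eqP|/(_ x)]; rewrite ?eqxx.
rewrite (eq_bigl _ _ FE) sum1_card card_family foldrE big_map big_enum /=.
rewrite (bigID (fun y => y \in codom J)) /= big1 => [|y /codomP[x ->]]; last first.
  by rewrite /F; case: pickP => [x' _|/(_ x)]; rewrite ?card1 ?eqxx.
rewrite mul1n (eq_bigr (fun=> #|I|)) => [|y yJ]; last first.
  rewrite /F; case: pickP => // x /eqP xy.
  by move: yJ; rewrite -xy codom_f.
rewrite prod_nat_const; congr (_ ^ _)%N.
by rewrite -(card_codom Jinj) -(cardC (mem (codom J))) addKn.
Qed.

(* Fractional Helly for the hulls of the T-indexed tuples: by pigeonhole one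
   Tverberg partition [c] works for a positive fraction of the tuples, and e+1
   tuples have intersecting hulls as soon as the tuple taking its i-th entry from
   the one numbered [c i] is partitioned by [c]. *)
Lemma first_selection (R : realType) e : exists (T : finType) (c : nat),
  forall (I : finType) (y : I -> 'rV[R]_e), (0 < #|I|)%N ->
    exists x, (#|I| ^ #|T| <=
      c * #|[pred s : {ffun T -> I} | `[< hull (range (y \o s)) x >]]|)%N.
Proof.
have [T TP] := weak_tverberg R e e.
exists T, (e.+1 ^ #|T| * e.+1)%N => I y n0.
pose Q (c : {ffun T -> 'I_e.+1}) (t : {ffun T -> I}) :=
  `[< \bigcap_a hull [set y (t i) | i in [set i | c i = a]] !=set0 >].
have nT : (0 < #|{: {ffun T -> I}}|)%N by rewrite card_ffun expn_gt0 n0.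
have [c cP] : exists c, (#|{: {ffun T -> I}}| <= #|{: {ffun T -> 'I_e.+1}}| * #|Q c|)%N.
  apply: pigeonhole_card => // t _.
  have [c [z cz]] := TP (y \o t).
  (* Labels above [e] are sent to 0 by [inord], which only enlarges that class. *)
  exists [ffun i => inord (c i)]; apply/asboolP; exists z => a _.
  apply: hull_mono (cz a (ltn_ord a)) => _ [i /= ca <-].
  by exists i => //=; rewrite ffunE ca inord_val.
pose J i := (c i, i); have Jinj : injective J by move=> i j [].
pose K (s : {ffun T -> I}) := hull (range (y \o s)).
have cK s : convex_set (K s) by exact: convex_hull.
pose f (t : {ffun 'I_e.+1 * T -> I}) : {ffun 'I_e.+1 -> {ffun T -> I}} :=
  [ffun a => [ffun i => t (a, i)]].
have f_inj : injective f.
  move=> s t /ffunP st; apply/ffunP => -[a i].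
  by have /ffunP/(_ i) := st a; rewrite !ffunE.
have [|x xP] := @fractional_helly R e _ K (e.+1 ^ #|T|) cK nT; last first.
  by exists x; rewrite -card_ffun.
pose m := (e.+1 * #|T| - #|T|)%N.
apply: (@leq_trans (e.+1 ^ #|T| * (#|Q c| * #|I| ^ m))); last first.
  rewrite leq_mul2l; apply/orP; right.
  have := card_precomp_inj (I := I) (Q c) Jinj.
  rewrite card_prod card_ord => <-; rewrite -(card_imset _ f_inj).
  apply: subset_leq_card; apply/fintype.subsetP => _ /imsetP[t + ->].
  rewrite !inE => -[z zP]; exists z => a _.
  apply: hull_mono (zP a Logic.I) => _ [i /= ca <-].
  by exists i => //=; rewrite !ffunE /J ca.
move: cP; rewrite !card_ffun card_ord => cP.
rewrite mulnA -expnM mulnC.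
have -> : (e.+1 * #|T| = #|T| + m)%N by rewrite subnKC// leq_pmull.
by rewrite expnD leq_mul2r cP orbT.
Qed.

(* Greedily add selection points of the sets not yet met: each one lies in the
   hulls of a positive fraction of all tuples, none of which was met before. *)
Lemma weak_net (R : realType) e E : exists N : nat,
  forall (I : finType) (y : I -> 'rV[R]_e), (0 < #|I|)%N ->
    exists2 X : seq 'rV[R]_e, (size X <= N)%N &
      forall K : set 'rV[R]_e, convex_set K -> (#|I| <= E * #|[pred i | `[< K (y i) >]]|)%N ->
        exists2 x, x \in X & K x.
Proof.
have [T [c cP]] := first_selection R e.
pose D := (E ^ #|T| * c)%N.
exists D => I y n0.
pose free (X : seq 'rV[R]_e) (s : {ffun T -> I}) :=
  `[< forall x, x \in X -> ~ hull (range (y \o s)) x >].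
(* The number [m] counts the remaining steps, each of which removes at least a fraction [1 / D] of
   all tuples from the free ones; [m = D] suffices at the start. *)
suff H m X : (D * #|free X| <= m * #|I| ^ #|T|)%N ->
    exists2 X' : seq 'rV[R]_e, (size X' <= m + size X)%N &
      forall K : set 'rV[R]_e, convex_set K -> (#|I| <= E * #|[pred i | `[< K (y i) >]]|)%N ->
        exists2 x, x \in X' & K x.
  have [|X' sX' X'P] := H D [::]; last by exists X'; rewrite ?addn0 in sX' *.
  by rewrite leq_mul2l -card_ffun max_card orbT.
have step (Z : seq 'rV[R]_e) :
    (forall K : set 'rV[R]_e, convex_set K -> (#|I| <= E * #|[pred i | `[< K (y i) >]]|)%N ->
      exists2 x, x \in Z & K x) \/
    exists x, (#|I| ^ #|T| + D * #|free (x :: Z)| <= D * #|free Z|)%N.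
  have [|/existsNP[K /not_implyP[cK /not_implyP[nK KZ]]]] := pselect
      (forall K : set 'rV[R]_e, convex_set K -> (#|I| <= E * #|[pred i | `[< K (y i) >]]|)%N ->
         exists2 x, x \in Z & K x); [by left | right].
  pose S := {i | `[< K (y i) >]}.
  have cS : #|{: S}| = #|[pred i | `[< K (y i) >]]| by rewrite card_sig.
  have S0 : (0 < #|{: S}|)%N.
    by rewrite lt0n cS; apply: contraTneq nK => ->; rewrite muln0 -ltnNge.
  have [x xP] := cP _ (fun i : S => y (val i)) S0.
  have hK (s : {ffun T -> S}) : hull (range ((fun i : S => y (val i)) \o s)) `<=` K.
    by apply: hull_sub => // _ [i _ <-] /=; case: (s i) => j /= /asboolP.
  exists x.
  pose f (s : {ffun T -> S}) : {ffun T -> I} := [ffun i => val (s i)].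
  have f_inj : injective f.
    move=> s t /ffunP st; apply/ffunP => i.
    by apply: val_inj; have := st i; rewrite !ffunE.
  have fE s : range (y \o f s) = range ((fun i : S => y (val i)) \o s).
    have -> // : y \o f s = (fun i : S => y (val i)) \o s.
    by apply/funext => i /=; rewrite ffunE.
  pose P (s : {ffun T -> S}) := `[< hull (range ((fun i : S => y (val i)) \o s)) x >].
  have new : (#|[pred s : {ffun T -> S} | P s]| + #|free (x :: Z)| <= #|free Z|)%N.
    rewrite -(card_imset _ f_inj) -cardUI.
    rewrite [X in (_ + X)%N]eq_card0 ?addn0 => [|t].
      apply: subset_leq_card; apply/fintype.subsetP => t.
      rewrite !inE => /orP[/imsetP[s]|/asboolP tZ].
        rewrite inE => sx -> z zZ; rewrite fE => hz.
        by apply: KZ; exists z => //; exact: hK hz.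
      by move=> z zZ; apply: tZ; rewrite inE zZ orbT.
    rewrite !inE; apply/negP => /andP[/imsetP[s + ->] /asboolP /(_ x (mem_head _ _))].
    by rewrite inE fE.
  apply: leq_trans (leq_mul (leqnn D) new); rewrite mulnDr leq_add2r.
  apply: leq_trans (_ : (E * #|{: S}|) ^ #|T| <= _)%N.
    by case: #|T| => [|k]; rewrite ?expn0// leq_exp2r// cS.
  by rewrite expnMn /D -mulnA leq_mul2l xP orbT.
elim: m X => [|m IH] X Xm; have [net|[x xP]] := step X.
- by exists X.
- have : (0 < #|I| ^ #|T|)%N by rewrite expn_gt0 n0.
  move: Xm; rewrite mul0n leqn0 => /eqP Xm.
  by move: xP; rewrite Xm leqn0 addn_eq0 eqn0Ngt => /andP[/negP].
- by exists X => //; rewrite leq_addl.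
- have [|X' sX' X'P] := IH (x :: X); last first.
    by exists X' => //; rewrite addSnnS.
  by rewrite -(leq_add2l (#|I| ^ #|T|)) (leq_trans xP)// -mulSn.
Qed.

(** * The (p, q)-theorem and separating hyperplanes *)

(** Bernoulli's inequality for [(1 + 1 / a) ^ (a + 1)]; it controls the weights in the next
    lemma. *)
Lemma double_expn_succ a : (0 < a)%N -> (2 * a ^ a.+1 <= a.+1 ^ a.+1)%N.
Proof.
move=> a0; have H n : (a ^ n * (a + n) <= a.+1 ^ n * a)%N.
  elim: n => [|n IH]; first by rewrite addn0.
  rewrite !expnS; apply: (@leq_trans (a.+1 * (a ^ n * (a + n)))); last first.
    by rewrite -mulnA leq_mul2l IH orbT.
  rewrite -mulnA mulnCA (mulnCA a.+1) leq_mul2l; apply/orP; right; nia.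
rewrite -(leq_pmul2r a0); apply: leq_trans (H a.+1).
by rewrite -mulnA mulnCA leq_mul2l; apply/orP; right; lia.
Qed.

(* Multiplicative weights: repeatedly pick a point that is heavy for the weights
   [2 ^ (T - number of earlier points hitting b)]. *)
Lemma uniformly_dense_seq (B : finType) (X : Type) (hit : B -> X -> bool) A :
  (forall (I : finType) (m : I -> B), (0 < #|I|)%N ->
     exists x, (#|I| <= A * #|[pred i | hit (m i) x]|)%N) ->
  (0 < #|B|)%N ->
  exists2 Y : seq X, (0 < size Y)%N &
    forall b, (size Y <= 4 * A * count (hit b) Y)%N.
Proof.
move=> heavy B0.
have A0 : (0 < A)%N.
  by have [x] := heavy B id B0; case: (A) => // /(leq_trans B0).
have build T : exists2 Y : seq X, size Y = T &
    (A ^ T * \sum_b 2 ^ (T - count (hit b) Y) <= (2 * A).-1 ^ T * #|B|)%N.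
  elim: T => [|T [Y sY YP]].
    exists [::] => //; rewrite !mul1n (eq_bigr (fun=> 1%N)) ?sum1_card// => b _.
  pose w b := (2 ^ (T - count (hit b) Y))%N.
  pose I := {b : B & 'I_(w b)}.
  have cI (P : pred B) : #|[pred i : I | P (tag i)]| = (\sum_(b | P b) w b)%N.
    rewrite -sum1_card; under [RHS]eq_bigr do rewrite -[w _]card_ord -sum1_card.
    by rewrite (sig_big_dep _ _ (fun _ _ => 1%N)) /=; apply: eq_bigl => i; rewrite andbT.
  have wT : #|{: I}| = (\sum_b w b)%N by rewrite -(cI predT); apply: eq_card.
  have I0 : (0 < #|{: I}|)%N.
    have /card_gt0P[b _] := B0; rewrite wT (bigD1 b) //=.
    by rewrite ltn_addr// expn_gt0.
  have [x] := heavy _ (@tag _ _ : I -> B) I0; rewrite wT (cI (hit^~ x)) => xP.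
  exists (x :: Y); first by rewrite /= sY.
  set W' := (\sum_b _)%N.
  (* Extending [Y] doubles the weight of the unhit members and keeps that of the hit ones, so the
     total grows by a factor of at most [2 - 1 / A]. *)
  have W'E : (W' + \sum_(b | hit b x) w b = 2 * \sum_b w b)%N.
    rewrite [X in (_ + X)%N]big_mkcond -big_split big_distrr /=; apply: eq_bigr => b _.
    have cT : (count (hit b) Y <= T)%N by rewrite -sY count_size.
    case: (hit b x); first by rewrite add1n subSS mul2n addnn.
    by rewrite add0n addn0 subSn// expnS.
  have : (A * W' <= (2 * A).-1 * \sum_b w b)%N by nia.
  move=> /(leq_mul (leqnn (A ^ T))) h.
  rewrite !expnSr -!mulnA; apply: leq_trans h _.
  by rewrite mulnCA [leqRHS]mulnCA leq_mul2l YP orbT.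
(* Every [2 * A] rounds cost the total at least a factor of 2 against pure doubling; [2 * #|B|] such
   blocks force each count up to [#|B|], a fraction [1 / (4 * A)] of the length. *)
have [Y sY YP] := build (2 * A * (2 * #|B|))%N.
exists Y => [|b]; first by rewrite sY !muln_gt0 A0 B0.
have cY : (count (hit b) Y <= size Y)%N by exact: count_size.
suff : (#|B| <= count (hit b) Y)%N by rewrite sY; nia.
move: YP; rewrite (bigD1 b) //= -sY; set n := count _ _; set T := size Y => YP.
have : (A ^ T * 2 ^ (T - n) <= (2 * A).-1 ^ T * #|B|)%N.
  by apply: leq_trans YP; rewrite leq_mul2l leq_addr orbT.
move=> /(leq_mul (leqnn (2 ^ n))).
rewrite mulnCA -expnD subnKC// mulnC -expnMn => h.
have a0 : (0 < (2 * A).-1)%N by lia.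
have := double_expn_succ a0; rewrite prednK ?muln_gt0// => dbl.
have h2 : (2 ^ (2 * #|B|) * (2 * A).-1 ^ T <= (2 * A) ^ T)%N.
  by rewrite /T sY !(expnM _ (2 * A)%N) -expnMn leq_exp2r// muln_gt0.
have : (2 ^ (2 * #|B|) <= #|B| * 2 ^ n)%N.
  rewrite -(leq_pmul2r (m := ((2 * A).-1 ^ T)%N)) ?expn_gt0 ?a0//.
  by apply: leq_trans h2 _; apply: leq_trans h _; rewrite mulnCA mulnC (mulnC #|B|).
move=> h3; have : (2 ^ (2 * #|B|) <= 2 ^ (#|B| + n))%N.
  by apply: leq_trans h3 _; rewrite expnD leq_mul2r ltnW ?orbT// ltn_expl.
by rewrite leq_exp2l// mul2n -addnn leq_add2l.
Qed.

(* The (p, q)-theorem of Alon and Kleitman with p = #|P| * e + 1, q = e + 1, for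
   disjoint unions of convex sets lying in #|P| copies of R^e. The tuples [t] and
   the positions selected in them may repeat members of the family. *)
Lemma piercing_of_pq (R : realType) e (P : finType) : exists f : nat,
  forall (B : finType) (b : B -> P -> set 'rV[R]_e),
    (forall k i, convex_set (b k i)) ->
    (forall t : {ffun 'I_(#|P| * e).+1 -> B}, exists i (J : {ffun 'I_e.+1 -> 'I_(#|P| * e).+1}),
       injective J /\ \bigcap_j b (t (J j)) i !=set0) ->
    exists2 X : seq 'rV[R]_e, (size X <= f)%N &
      forall k, exists i, exists2 x, x \in X & b k i x.
Proof.
set p := (#|P| * e).+1.
pose S : finType := (P * {ffun 'I_e.+1 -> 'I_p})%type.
pose A := (#|S| * e.+1)%N.
(* The factor [#|P|] pays for passing to the copy that receives the most hits of a given member. *)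
have [N NP] := weak_net R e (4 * A * #|P|).
exists N => B b cb pq.
have [B0|B0] := posnP #|B|.
  by exists [::] => // k; have := card0_eq B0 k.
pose hit k (q : P * 'rV[R]_e) := `[< b k q.1 q.2 >].
have [|Y Y0 YP] := @uniformly_dense_seq B _ hit A _ B0.
  move=> I m n0.
  pose Q (s : S) (t : {ffun 'I_p -> I}) :=
    injectiveb s.2 && `[< \bigcap_j b (m (t (s.2 j))) s.1 !=set0 >].
  have [||[i J] iJ] := @pigeonhole_card {ffun 'I_p -> I} S predT Q.
  - by rewrite card_ffun expn_gt0 n0.
  - move=> t _; have [i [J [Jinj ne]]] := pq [ffun a => m (t a)].
    exists (i, J); apply/andP; split; first exact/injectiveP.
    apply/asboolP; case: ne => x xP; exists x => j _.
    by have := xP j Logic.I; rewrite ffunE.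
  have Jinj : injective J.
    apply/injectiveP; apply: contraT => nJ; move: iJ.
    rewrite [#|Q _|]eq_card0 ?muln0 => [|t]; last by rewrite inE /Q /= (negPf nJ).
    by rewrite leqn0 card_ffun expn_eq0 eqn0Ngt n0.
  (* For fixed [i] and [J], only the [e + 1] entries along [J] matter and the others are free, so a
     positive fraction of [p]-tuples yields the same fraction of [e + 1]-tuples. *)
  pose G := [pred u : {ffun 'I_e.+1 -> I} | `[< \bigcap_j b (m (u j)) i !=set0 >]].
  have GP : (#|Q (i, J)| <= #|[pred t : {ffun 'I_p -> I} | G [ffun x => t (J x)]]|)%N.
    apply: subset_leq_card; apply/fintype.subsetP => t.
    rewrite !inE /Q /= => /andP[_ /asboolP[x xP]]; exists x => j _.
    by rewrite ffunE; exact: xP.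
  rewrite card_precomp_inj// !card_ord in GP.
  have ep : (e < p)%N by have := leq_card J Jinj; rewrite !card_ord.
  have [|x xP] := @fractional_helly R e I (fun k => b (m k) i) #|S|
    (fun k => cb (m k) i) n0; last first.
    by exists (i, x); rewrite /A.
  rewrite -(leq_pmul2r (m := (#|I| ^ (p - e.+1))%N)) ?expn_gt0 ?n0//.
  rewrite -expnD subnKC// -mulnA.
  apply: leq_trans (_ : #|S| * #|Q (i, J)| <= _)%N; last by rewrite leq_mul2l GP orbT.
  by apply: leq_trans iJ; rewrite card_ffun card_ord.
pose y (t : 'I_(size Y)) := (tnth (in_tuple Y) t).2.
have [|X sX XP] := NP _ y; first by rewrite card_ord.
exists X => // k.
have cY : count (hit k) Y = #|[pred t : 'I_(size Y) | hit k (tnth (in_tuple Y) t)]|.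
  by rewrite -sum1_card -sum1_count big_tnth.
have [||i iP] := @pigeonhole_card _ P [pred t : 'I_(size Y) | hit k (tnth (in_tuple Y) t)]
  (fun i => [pred t | `[< b k i (y t) >]]).
- rewrite -cY lt0n; apply: contraTneq (YP k) => ->.
  by rewrite muln0 -ltnNge.
- by move=> t; exists (tnth (in_tuple Y) t).1.
have [|x xX bx] := XP (b k i) (cb k i); last by exists i, x.
rewrite card_ord -mulnA; apply: leq_trans (YP k) _.
by rewrite cY leq_mul2l iP orbT.
Qed.

(** * Hyperplanes crossing a family of convex sets *)

Lemma convex_dot_ivt (R : realFieldType) n (K : set 'rV[R]_n) a c x y :
  convex_set K -> K x -> K y -> dot a x < c -> c <= dot a y ->
  exists2 z, K z & dot a z = c.
Proof.
move=> /convex_setE cK Kx Ky xc cy.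
have d0 : 0 < dot a y - dot a x by lra.
pose t := (c - dot a x) / (dot a y - dot a x).
have t0 : 0 <= t by rewrite divr_ge0//; lra.
have t1 : t <= 1 by rewrite ler_pdivrMr//; lra.
exists (t *: y + (1 - t) *: x); first exact: cK.
rewrite dotDr !dotZr; have : t * (dot a y - dot a x) = c - dot a x.
  by rewrite divfK// lt0r_neq0.
lra.
Qed.

Lemma dot_sumr (R : comPzRingType) n (I : finType) (x : 'rV[R]_n) (y : I -> 'rV[R]_n) :
  dot x (\sum_i y i) = \sum_i dot x (y i).
Proof.
elim/big_rec2 : _ => [|i u v _ <-]; last by rewrite dotDr.
by rewrite dotC dot0l.
Qed.

Lemma dot_mxvec (R : comPzRingType) m n (A B : 'M[R]_(m, n)) :
  dot (mxvec A) (mxvec B) = \sum_i dot (row i A) (row i B).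
Proof.
rewrite /dot (reindex (uncurry (@mxvec_index m n))) /=;
  last exact: subon_bij (curry_mxvec_bij _ _).
rewrite pair_bigA /=; apply: eq_bigr => -[i j] _ /=.
by rewrite !mxvecE !mxE.
Qed.

(* Convex sets without a common point are contained in closed half-spaces
   without a common point. The half-spaces are found as in Farkas' lemma: the
   vectors [(p_j - p_0)_j] with [p_j] in the j-th set form a polytope missing 0. *)
Lemma crossing_hyperplanes (R : realType) e n (b : 'I_n.+1 -> set 'rV[R]_e)
    (G : finType) (g : G -> set 'rV[R]_e) :
  (forall j, convex_set (b j)) -> (forall k, convex_set (g k)) ->
  ~ (\bigcap_j b j !=set0) -> (forall k j, g k `&` b j !=set0) ->
  exists (a : 'I_n.+1 -> 'rV[R]_e) (c : 'I_n.+1 -> R),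
    forall k, exists j, a j != 0 /\ exists2 z, g k z & dot (a j) z = c j.
Proof.
move=> cb cg nob gb.
have [G0|/card_gt0P[k0 _]] := posnP #|G|.
  by exists (fun=> 0), (fun=> 0) => k; have := card0_eq G0 k.
have /choice[p /all_and2[gp bp]] : forall kj : G * 'I_n.+1, exists x, g kj.1 x /\ b kj.2 x.
  by move=> [k j]; have [x []] := gb k j; exists x.
pose w (s : {ffun 'I_n.+1 -> G}) : 'rV[R]_(n.+1 * e) :=
  mxvec (\matrix_j (p (s j, j) - p (s ord0, ord0))).
have [|v vw vmin] := closed_argmin (@hull_finite_closed R _ _ w).
  by exists (w [ffun=> k0]); apply: sub_hull; exists [ffun=> k0].
have v0 : v != 0.
  apply/negP => /eqP v0; apply: nob; move: vw; rewrite v0.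
  (* Differences of this form make up a convex set containing every [w s]; were 0 in it, all [y j]
     would coincide in a common point of the [b j]. *)
  pose D := [set u : 'rV[R]_(n.+1 * e) | exists y : 'I_n.+1 -> 'rV[R]_e,
    (forall j, b j (y j)) /\ forall j, row j (vec_mx u) = y j - y ord0].
  have : hull (range w) `<=` D.
    apply: hull_sub.
      apply/convex_setE => u u' t t0 t1 [y [yb yE]] [y' [y'b y'E]].
      exists (fun j => t *: y j + (1 - t) *: y' j); split=> j.
        by have /convex_setE := cb j; apply.
      have -> : row j (vec_mx (t *: u + (1 - t) *: u')) =
          t *: row j (vec_mx u) + (1 - t) *: row j (vec_mx u').
        by rewrite !linearD /= !linearZ_LR.
      by rewrite yE y'E !scalerBr opprD addrACA.
    move=> _ [s _ <-]; exists (fun j => p (s j, j)); split=> [j|j]; first exact: bp (s j, j).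
    by rewrite mxvecK rowK.
  move=> /[apply] -[y [yb yE]]; exists (y ord0) => j _.
  have := yE j; rewrite linear0 row0 => /esym/eqP; rewrite subr_eq0 => /eqP <-.
  exact: yb.
have vdot s : 0 < dot v (w s).
  apply: lt_le_trans (convex_argmin_dot (@convex_hull _ _ _) vw _ vmin); last first.
    by apply: sub_hull; exists s.
  rewrite lt_neqAle dot_ge0 andbT eq_sym; apply/negP => /eqP /dot_eq0 vv.
  by rewrite vv eqxx in v0.
pose V := vec_mx v; pose sV := \sum_j row j V.
(* The row of index 0 is replaced by minus the sum of the others, so the [a j] sum to 0 and
   [dot v (w s)] becomes the sum of [dot (a j) (p (s j, j))]. *)
pose a j := if j == ord0 then row j V - sV else row j V.
have suma z : \sum_j dot (a j) z = 0.
  rewrite (eq_bigr (fun j => dot z (a j))) => [|j _]; last exact: dotC.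
  rewrite -dot_sumr (bigD1 ord0) //= /a eqxx.
  rewrite (eq_bigr (fun j => row j V)) => [|j /negPf -> //].
  by rewrite addrAC /sV [X in _ - X](bigD1 ord0) //= subrr dotC dot0l.
have dot_w s : dot v (w s) = \sum_j dot (a j) (p (s j, j)).
  rewrite -[v in LHS]vec_mxK -/V /w dot_mxvec.
  pose q := p (s ord0, ord0).
  transitivity (\sum_j dot (row j V) (p (s j, j)) - dot sV q).
    rewrite (dotC sV) dot_sumr -sumrB; apply: eq_bigr => j _.
    by rewrite rowK dotDr -scaleN1r dotZr mulN1r (dotC q).
  rewrite [RHS](bigD1 ord0) //= [X in X - _](bigD1 ord0) //= /a eqxx.
  have sVN : dot (- sV) q = - dot sV q by rewrite -scaleN1r dotZl mulN1r.
  rewrite dotDl sVN addrAC; congr (_ + _).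
  by apply: eq_bigr => j /negPf ->.
(* The half-space where [dot (a j)] is at least this minimum contains every chosen point of [b j].
   The minima have positive sum, so the half-spaces have no common point; yet a [g k] crossing no
   boundary would lie in all of them. *)
pose m j := [arg min_(k < k0) dot (a j) (p (k, j))]%O.
have mP j k : dot (a j) (p (m j, j)) <= dot (a j) (p (k, j)).
  by rewrite /m; case: arg_minP => // i _; apply.
exists a, (fun j => dot (a j) (p (m j, j))) => k; apply: contrapT => /forallNP no.
pose z := p (k, ord0).
have : \sum_j dot (a j) (p (m j, j)) <= \sum_j dot (a j) z.
  apply: ler_sum => j _; rewrite leNgt; apply/negP => lt.
  have [aj|aj] := eqVneq (a j) 0; first by rewrite aj !dot0l ltxx in lt.
  apply: (no j); split => //.
  exact: convex_dot_ivt (cg k) (gp (k, ord0)) (gp (k, j)) lt (mP j k).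
rewrite suma leNgt => /negP; apply.
by have := vdot [ffun j => m j]; rewrite dot_w; under eq_bigr do rewrite ffunE.
Qed.

(** A tuple [t] violating the (p, q)-condition yields the second alternative. One group of [e + 1]
    hyperplanes per copy and selection suffices, so [H] depends only on [e] and [P]. *)
Lemma pierced_or_crossed (R : realType) e (P : finType) :
  exists (f : nat) (H : finType), forall (B G : finType)
    (b : B -> P -> set 'rV[R]_e) (g : G -> P -> set 'rV[R]_e),
    (forall k i, convex_set (b k i)) -> (forall k i, convex_set (g k i)) ->
    (forall k l, exists i, b k i `&` g l i !=set0) ->
    (exists2 X : seq 'rV[R]_e, (size X <= f)%N &
       forall k, exists i, exists2 x, x \in X & b k i x) \/
    (exists (a : H -> 'rV[R]_e) (c : H -> R), forall l, exists i h,
       a h != 0 /\ exists2 z, g l i z & dot (a h) z = c h).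
Proof.
have [f fP] := piercing_of_pq R e P.
pose p := (#|P| * e).+1.
pose S : finType := (P * {ffun 'I_e.+1 -> 'I_p})%type.
exists f, (S * 'I_e.+1)%type => B G b g cb cg bg.
have [pq|/existsNP[t nt]] := pselect (forall t : {ffun 'I_p -> B},
  exists i (J : {ffun 'I_e.+1 -> 'I_p}),
    injective J /\ \bigcap_j b (t (J j)) i !=set0); [left; exact: fP | right].
have /choice[h hP] : forall s : S,
    exists ac : ('I_e.+1 -> 'rV[R]_e) * ('I_e.+1 -> R), injective s.2 ->
      forall l, (forall j, g l s.1 `&` b (t (s.2 j)) s.1 !=set0) ->
        exists j, ac.1 j != 0 /\ exists2 z, g l s.1 z & dot (ac.1 j) z = ac.2 j.
  move=> [i J] /=; have [Jinj|nJ] := pselect (injective J);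
    last by exists (fun=> 0, fun=> 0) => /nJ.
  pose G' := {l | `[< forall j, g l i `&` b (t (J j)) i !=set0 >]}.
  have [||||a [c ac]] := @crossing_hyperplanes R e e
    (fun j => b (t (J j)) i) G' (fun l => g (val l) i).
  - by move=> j.
  - by move=> l.
  - by move=> ne; apply: nt; exists i, J.
  - by move=> [l /= /asboolP lP] j; exact: lP.
  exists (a, c) => /= _ l lP.
  have lP' : `[< forall j, g l i `&` b (t (J j)) i !=set0 >] by apply/asboolP.
  exact: ac (Sub l lP').
exists (fun s => (h s.1).1 s.2), (fun s => (h s.1).2 s.2) => l.
have /choice[q qP] : forall k : 'I_p, exists i, b (t k) i `&` g l i !=set0.
  by move=> k; exact: bg.
have [||i iP] := @pigeonhole_card _ P predT (fun i => [pred k : 'I_p | q k == i]).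
- by rewrite card_ord.
- by move=> k _; exists (q k); rewrite /= eqxx.
have ei : (e < #|[pred k : 'I_p | q k == i]|)%N.
  by move: iP; rewrite card_ord ltnNge; apply: contraL => h1;
    rewrite -ltnNge ltnS leq_mul2l h1 orbT.
pose J := [ffun j : 'I_e.+1 => enum_val (widen_ord ei j)].
have Jinj : injective J.
  by move=> j j'; rewrite !ffunE => /enum_val_inj /(congr1 val) /= /val_inj.
have qJ j : q (J j) = i.
  by rewrite ffunE; have := enum_valP (widen_ord ei j); rewrite inE => /eqP.
have [|j jP] := hP (i, J) Jinj l; last by exists i, ((i, J), j).
by move=> j /=; rewrite setIC -(qJ j).
Qed.

(** * Colorful families *)

Lemma hyperplane_parametrization (R : realFieldType) e (a : 'rV[R]_e.+1) (c : R) :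
  a != 0 -> exists q : 'rV[R]_e.+1 * 'M[R]_(e, e.+1),
    forall z, dot a z = c -> exists x, z = q.1 + x *m q.2.
Proof.
move=> a0; have aa0 : dot a a != 0 by apply: contra_neq a0; exact: dot_eq0.
pose K := kermx a^T.
have [A KA] : exists A : 'M[R]_(e, e.+1), (K <= A)%MS.
  have rK : \rank K = e by rewrite mxrank_ker mxrank_tr rank_rV a0 subn1.
  suff H r (B : 'M_(r, e.+1)) : r = e -> (K <= B)%MS -> exists A : 'M_(e, e.+1), (K <= A)%MS.
    by apply: (H _ (row_base K) rK); rewrite eq_row_base.
  by move=> re; move: B; rewrite re => B; exists B.
exists ((c / dot a a) *: a, A) => z az.
have dotE (x : 'rV[R]_e.+1) : x *m a^T = (dot a x)%:M.
  apply/rowP => i; rewrite !ord1 !mxE /= mulr1n; apply: eq_bigr => j _.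
  by rewrite mxE mulrC.
have : (z - (c / dot a a) *: a <= K)%MS.
  rewrite sub_kermx mulmxBl -scalemxAl !dotE az scale_scalar_mx divfK//.
  by rewrite subrr.
move=> /submx_trans/(_ KA)/submxP[x zx]; exists x.
by rewrite -zx addrC subrK.
Qed.

Lemma convex_affine_preimage (R : numDomainType) e d (p : 'rV[R]_d) (A : 'M[R]_(e, d))
    (K : set 'rV[R]_d) :
  convex_set K -> convex_set [set x : 'rV[R]_e | K (p + x *m A)].
Proof.
move=> /convex_setE cK; apply/convex_setE => x y t t0 t1 /= Kx Ky.
suff -> : p + (t *: x + (1 - t) *: y) *m A =
    t *: (p + x *m A) + (1 - t) *: (p + y *m A) by exact: cK.
rewrite mulmxDl -!scalemxAl !scalerDr addrACA -scalerDl.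
by rewrite addrC (addrC t) subrK scale1r addrC.
Qed.

(** Induction on the number [l] of bad classes used: each lowers the dimension [e] by one. Flats are
    kept as parametrizations by a point and a matrix, so that sets pull back to convex sets in the
    parameter space. *)
Lemma rainbow_intersections_cross_flats (R : realType) (l d e : nat) : (l + e)%N = d ->
  exists (f : nat) (H : finType), forall (I : finType) (K : I -> set 'rV[R]_d)
    (C : 'I_d.+1 -> pred I) (S : {set 'I_d.+1}),
    (forall k, convex_set (K k)) ->
    (forall t : 'I_d.+1 -> I, (forall j, C j (t j)) -> \bigcap_j K (t j) !=set0) ->
    #|S| = l ->
    (forall j, j \in S -> ~ exists2 X : seq 'rV[R]_d, (size X <= f)%N &
       forall k, C j k -> exists2 x, x \in X & K k x) ->
    exists Q : H -> 'rV[R]_d * 'M[R]_(e, d),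
      forall t : 'I_d.+1 -> I, (forall j, C j (t j)) ->
        exists h x, forall j, j \notin S -> K (t j) ((Q h).1 + x *m (Q h).2).
Proof.
elim: l e => [|l IH] e led.
  rewrite add0n in led; exists 0%N, unit => I K C S cK cap /cards0_eq -> _.
  rewrite led; exists (fun=> (0, 1%:M)) => t tC.
  have [x xK] := cap t tC; exists tt, x => j _.
  by rewrite mulmx1 add0r; exact: xK.
have [|f0 [H0 P0]] := IH e.+1; first by rewrite addnS.
have [f1 [H1 P1]] := pierced_or_crossed R e.+1 H0.
(* A piercing set of at most [f1] points in the parameter space is mapped by all [#|H0|]
   parametrizations. *)
exists (maxn f0 (#|H0| * f1)), (H0 * H1)%type => I K C S cK cap cS bad.
have [j0 j0S] : exists j, j \in S by apply/card_gt0P; rewrite cS.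
have [||Q0 Q0P] := P0 I K C (S :\ j0)%SET cK cap.
- by have := cardsD1 j0 S; rewrite cS j0S add1n => -[].
- move=> j; rewrite in_setD1 => /andP[_ jS] [X sX XP]; apply: (bad j jS).
  by exists X => //; rewrite leq_max sX.
pose B := {k | C j0 k}.
pose G := {t : {ffun 'I_d.+1 -> I} | [forall j, C j (t j)]}.
pose b (k : B) i := [set x | K (val k) ((Q0 i).1 + x *m (Q0 i).2)].
pose g (t : G) i := \bigcap_(j in [set j | j \notin S])
  [set x | K (val t j) ((Q0 i).1 + x *m (Q0 i).2)].
have [|||[X sX XP]|[a [c acP]]] := P1 B G b g.
- by move=> k i; exact: convex_affine_preimage.
- by move=> t i; apply: convex_bigcap => j _; exact: convex_affine_preimage.
(* Exchanging the entry of [t] at [j0] for [k] keeps the selection rainbow; its intersection off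
   [S :\ j0] meets a flat in a point of [k] and of all entries of [t] off [S]. *)
- move=> k t; pose t' j := if j == j0 then val k else val t j.
  have [|i [x xP]] := Q0P t'.
    move=> j; rewrite /t'; case: eqP => [->|_]; first exact: (valP k).
    by have /forallP := valP t.
  exists i, x; split.
    by have := xP j0; rewrite /t' eqxx; apply; rewrite in_setD1 eqxx.
  move=> j /= jS; have := xP j; rewrite /t'; case: eqP => [jj|_]; first by rewrite jj j0S in jS.
  by apply; rewrite in_setD1 negb_and jS orbT.
- case: (bad j0 j0S); exists [seq (Q0 i).1 + x *m (Q0 i).2 | i <- enum H0, x <- X].
    by rewrite size_allpairs -cardE leq_max leq_mul2l sX !orbT.
  move=> k Ck; have [i [x xX kx]] := XP (Sub k Ck).
  exists ((Q0 i).1 + x *m (Q0 i).2) => //.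
  by apply/allpairsP; exists (i, x); rewrite mem_enum.
have /choice[q qP] : forall h, exists q : 'rV[R]_e.+1 * 'M[R]_(e, e.+1),
    a h != 0 -> forall z, dot (a h) z = c h -> exists x, z = q.1 + x *m q.2.
  move=> h; have [ah|/hyperplane_parametrization] := eqVneq (a h) 0.
    by exists (0, 0).
  by move=> /(_ (c h))[q qP]; exists q.
exists (fun ih => ((Q0 ih.1).1 + (q ih.2).1 *m (Q0 ih.1).2, (q ih.2).2 *m (Q0 ih.1).2)).
move=> t tC.
have tG : [forall j, C j ([ffun j => t j] j)] by apply/forallP => j; rewrite ffunE.
have [i [h [ah [z zP /(qP h ah)[x zx]]]]] := acP (Sub [ffun j => t j] tG).
exists (i, h), x => j jS; have := zP j jS; rewrite /= ffunE zx.
by rewrite mulmxDl addrA mulmxA.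
Qed.

(** * Flats, finite lists and relabelings *)

Lemma vspace_extension (F : fieldType) (vT : vectType F) (W : {vspace vT}) k :
  (\dim W <= k)%N -> (k <= dim vT)%N ->
  exists2 U : {vspace vT}, (W <= U)%VS & \dim U = k.
Proof.
move=> Wk kd; pose X := take (k - \dim W) (vbasis W^C).
have fX : free X.
  have := basis_free (vbasisP W^C); rewrite -(cat_take_drop (k - \dim W) (vbasis _)).
  exact: catl_free.
have sX : size X = (k - \dim W)%N.
  by rewrite size_takel// size_tuple dimv_compl dimvf leq_sub2r.
have XW : (<<X>> <= W^C)%VS.
  by apply/span_subvP => x /mem_take; exact: vbasis_mem.
exists (W + <<X>>)%VS; first exact: addvSl.
rewrite dimv_disjoint_sum; last first.
  by apply/eqP; rewrite -subv0 -(capv_compl W) capvS.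
by move/eqP: fX => ->; rewrite sX subnKC.
Qed.

(** The matrix may have rank below [k], so its row space is enlarged to dimension exactly [k]. *)
Lemma flat_of_parametrization (R : realType) k d (p : 'rV[R]_d) (A : 'M[R]_(k, d)) :
  (k <= d)%N -> exists2 L : set 'rV[R]_d, flat k L & forall x, L (p + x *m A).
Proof.
move=> kd.
pose rows := [seq row i A | i <- enum 'I_k].
pose W := <<rows>>%VS.
have dW : (\dim W <= k)%N.
  by apply: leq_trans (dim_span _) _; rewrite size_map size_enum_ord.
have [U WU dU] : exists2 U : {vspace 'rV[R]_d}, (W <= U)%VS & \dim U = k.
  by apply: vspace_extension; rewrite // dim_matrix mul1r.
exists [set p + u | u in [set` U]]; first by exists p, U.
move=> x; exists (x *m A) => //=.
rewrite mulmx_sum_row; apply: memv_suml => i _; apply: memvZ.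
apply: (subvP WU); apply: memv_span; apply/mapP; exists i => //.
by rewrite mem_enum.
Qed.

Lemma card_le_seq (T : eqType) (x0 : T) (s : seq T) n :
  (size s <= n)%N -> ([set x | x \in s] #<= `I_n)%card.
Proof.
move=> sn; apply: card_le_trans (card_image_le (nth x0 s) `I_n).
apply: subset_card_le => x /= xs; exists (index x s); last exact: nth_index.
by rewrite /=; apply: leq_trans sn; rewrite index_mem.
Qed.

Lemma pierced_by_seq (R : realType) d n (F : set (set 'rV[R]_d)) (X : seq 'rV[R]_d) :
  (size X <= n)%N -> (forall K, F K -> exists2 x, x \in X & K x) ->
  pierced_by_points n F.
Proof.
by move=> sX XP; exists [set x | x \in X]; split; first exact: (card_le_seq 0 sX).
Qed.

Lemma crossed_by_seq (R : realType) d n k (F : set (set 'rV[R]_d))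
    (X : seq (set 'rV[R]_d)) :
  (size X <= n)%N -> (forall L, L \in X -> flat k L) ->
  (forall K, F K -> exists2 L, L \in X & K `&` L !=set0) ->
  crossed_by_flats n k F.
Proof.
by move=> sX Xk XP; exists [set L | L \in X]; split => //; exact: (card_le_seq set0 sX).
Qed.

Lemma perm_splitting (d : nat) (U : {set 'I_d.+1}) :
  exists s : 'S_d.+1, forall j, (s j \in U) = (d.+1 - #|U| <= j)%N.
Proof.
have sE : (size (enum (~: U)) + size (enum U) = d.+1)%N.
  by rewrite -!cardE addnC cardsC card_ord.
pose e := enum (~: U) ++ enum U.
have se : size e = d.+1 by rewrite size_cat.
have ue : uniq e.
  rewrite cat_uniq !enum_uniq /= andbT; apply/hasPn => j.
  by rewrite !mem_enum finset.in_setC negbK.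
have s_inj : injective (fun j : 'I_d.+1 => nth ord0 e j).
  move=> i j /eqP; rewrite nth_uniq ?se ?ltn_ord// => /eqP; exact: val_inj.
exists (perm s_inj) => j; rewrite permE nth_cat.
have -> : (d.+1 - #|U|)%N = size (enum (~: U)).
  by rewrite -cardE [RHS]cardsCs finset.setCK card_ord.
rewrite [RHS]leqNgt; case: ltnP => jU /=.
  by apply/negbTE; rewrite -finset.in_setC -mem_enum mem_nth.
rewrite -mem_enum mem_nth// -(ltn_add2l (size (enum (~: U)))) subnKC// sE.
exact: ltn_ord.
Qed.

Lemma size_flatten_le (T : Type) n m (X : 'I_n -> seq T) :
  (forall j, size (X j) <= m)%N ->
  (size (flatten [seq X j | j <- enum 'I_n]) <= n * m)%N.
Proof.
move=> sX; rewrite size_flatten sumnE /shape -map_comp big_map big_enum /=.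
by rewrite -[n in (n * m)%N]card_ord -sum_nat_const; exact: leq_sum.
Qed.

(** * Good and bad color classes *)

Lemma pierced_or_crossed_by_flats (R : realType) (d : nat) : (0 < d)%N ->
  exists f g : nat,
  forall (F : set (set 'rV[R]_d)) (C : 'I_d.+1 -> set (set 'rV[R]_d)),
    finite_set F -> convex_family F -> colored F C -> (forall i, C i !=set0) ->
    colorful_helly C ->
    exists (k : nat) (s : 'S_d.+1),
      [/\ (1 <= k <= d)%N,
          pierced_by_points f (\bigcup_(j in [set j : 'I_d.+1 | (j < k)%N]) C (s j)) &
          crossed_by_flats g k (\bigcup_(j in [set j : 'I_d.+1 | (k <= j)%N]) C (s j))].
Proof.
move=> d0.
have /choice[f0 /choice[H HP]] : forall l : 'I_d.+1, exists f : nat, exists H : finType, _ :=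
  fun l => rainbow_intersections_cross_flats R (subnKC (leq_ord l : (l <= d)%N)).
(* The threshold for good classes is at least every [f0 l] and also the number of points that arise
   if all classes are bad. *)
pose f := maxn #|H ord_max| (\max_(l < d.+1) f0 l).
exists (d.+1 * f)%N, (d.+1 * \max_(l < d.+1) #|H l|)%N => F C finF cF CF C0 hC.
have [r FE] : exists r : seq (set 'rV[R]_d), F = [set K | K \in r] by apply/finite_seqP.
have Cr j K : C j K -> K \in r.
  move=> CK; suff : F K by rewrite FE.
  by rewrite CF; exists j.
pose I := 'I_(size r); pose K (i : I) := tnth (in_tuple r) i.
have Kr L : L \in r -> exists i, K i = L.
  by move=> /(tnthP (in_tuple r))[i ->]; exists i.
have cK i : convex_set (K i) by apply: cF; rewrite FE /=; exact: mem_tnth.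
pose C' j : pred I := fun i => `[< C j (K i) >].
have hC' (t : 'I_d.+1 -> I) : (forall j, C' j (t j)) -> \bigcap_j K (t j) !=set0.
  by move=> tC; apply: hC => j; apply/asboolP; exact: tC.
have /choice[t0 t0C] : forall j, exists i, C' j i.
  move=> j; have [L CL] := C0 j; have [i KiL] := Kr L (Cr j L CL).
  by exists i; apply/asboolP; rewrite KiL.
pose pierced j := exists2 X : seq 'rV[R]_d, (size X <= f)%N &
  forall k, C' j k -> exists2 x, x \in X & K k x.
pose U0 := [set j | ~~ `[< pierced j >]]%SET.
(* With no bad class, color 0 forms [U] so that [k = d] stays within bounds; [badU] is then vacuous,
   as it concerns members of [U] other than [u]. *)
pose U := if U0 == finset.set0 then [set ord0]%SET else U0.
have goodU j : j \notin U -> pierced j.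
  rewrite /U; case: eqP => [U00 _|_]; last by rewrite inE negbK => /asboolP.
  by have := finset.in_set0 j; rewrite -U00 inE => /negbFE /asboolP.
have badU u j : u \in U -> j \in U -> j != u -> ~ pierced j.
  rewrite /U; case: eqP => [_|_ _].
    by rewrite !finset.in_set1 => /eqP -> /eqP ->; rewrite eqxx.
  by rewrite inE => /asboolP.
have U_gt0 : (0 < #|U|)%N.
  by rewrite /U; case: eqP => [_|/eqP]; rewrite ?cards1// card_gt0.
have cross (l : 'I_d.+1) u : l = #|U|.-1 :> nat -> u \in U ->
    exists Q : H l -> 'rV[R]_d * 'M[R]_(d - l, d), forall k, C' u k ->
      exists h x, K k ((Q h).1 + x *m (Q h).2).
  move=> lU uU; have [|j|Q QP] := HP l I K C' (U :\ u)%SET cK hC'.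
  - by rewrite lU (cardsD1 u U) uU.
  - rewrite in_setD1 => /andP[ju jU] [X sX XP]; apply: (badU u j uU jU ju).
    exists X => //; apply: leq_trans sX _; rewrite leq_max.
    by rewrite (leq_bigmax l) orbT.
  (* The remaining colors are filled in from [t0], which exists because the classes are nonempty. *)
  - exists Q => k Ck; pose t j := if j == u then k else t0 j.
    have [|h [x xP]] := QP t.
      by move=> j; rewrite /t; case: eqP => [->|_].
    by exists h, x; have := xP u; rewrite /t eqxx; apply; rewrite in_setD1 eqxx.
(* If all classes were bad, the last one would be crossed by 0-flats after using up the [d] others,
   hence pierced by few points. *)
have Ud : (#|U| <= d)%N.
  rewrite leqNgt; apply/negP => dU.
  have cU : #|U| = d.+1.
    by apply/eqP; rewrite eqn_leq dU -[X in (_ <= X)%N]card_ord max_card.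
  have UT j : j \in U.
    have : #|(~: U)%SET| = 0%N by rewrite cardsCs finset.setCK cU card_ord subnn.
    by move/card0_eq => /(_ j); rewrite finset.in_setC => /negbFE.
  have [|Q QP] := cross ord_max ord_max _ (UT _); first by rewrite cU.
  apply: (badU ord0 ord_max) => //; first by rewrite -val_eqE /= -lt0n.
  exists [seq (Q h).1 | h <- enum (H ord_max)].
    by rewrite size_map -cardE leq_max leqnn.
  move=> k Ck; have [h [x Kx]] := QP k Ck; exists (Q h).1.
    by apply/mapP; exists h; rewrite ?mem_enum.
  have xA : x *m (Q h).2 = 0.
    apply/rowP => i; rewrite !mxE big1 // => j _.
    by have := ltn_ord j; rewrite [X in (_ < X)%N]subnn.
  by move: Kx; rewrite xA addr0.
have [s sP] := perm_splitting U.
exists (d.+1 - #|U|)%N, s; split.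
- by rewrite subn_gt0 ltnS Ud leq_subLR -[leqLHS]add1n leq_add2r.
- have /choice[X /all_and2[sX XP]] : forall j, exists X : seq 'rV[R]_d, (size X <= f)%N /\
      (j \notin U -> forall k, C' j k -> exists2 x, x \in X & K k x).
    move=> j; case: (boolP (j \in U)) => [_|/goodU[X sX XP]]; last by exists X.
    by exists [::].
  apply: (pierced_by_seq (size_flatten_le sX)) => L [j /= jk CL].
  have [i KiL] := Kr L (Cr _ _ CL).
  have [||x xX Kx] := XP (s j) _ i.
  + by rewrite sP -ltnNge.
  + by apply/asboolP; rewrite KiL.
  exists x; last by rewrite -KiL.
  by apply/flatten_mapP; exists (s j); rewrite ?mem_enum.
(* With the [#|U| - 1] other members of [U] used up, the flats have dimension
   [d - (#|U| - 1) = d + 1 - #|U|], which is the chosen [k]. *)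
pose l : 'I_d.+1 := inord #|U|.-1.
have lU : l = #|U|.-1 :> nat by rewrite inordK// prednK// ltnW.
have dlU : (d - l = d.+1 - #|U|)%N by rewrite lU -subSS prednK.
have /choice[X XP] : forall u, exists X : seq (set 'rV[R]_d),
    [/\ (size X <= #|H l|)%N, forall L, L \in X -> flat (d.+1 - #|U|) L &
      u \in U -> forall i, C' u i -> exists2 L, L \in X & K i `&` L !=set0].
  move=> u; case: (boolP (u \in U)) => [uU|_]; last by exists [::].
  have [Q QP] := cross l u lU uU.
  have /choice[L /all_and2[Lflat LQ]] : forall h, exists L : set 'rV[R]_d,
      flat (d - l) L /\ forall x, L ((Q h).1 + x *m (Q h).2).
    move=> h; have [L fL LP] := flat_of_parametrization (Q h).1 (Q h).2 (leq_subr _ _).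
    by exists L.
  exists [seq L h | h <- enum (H l)]; split.
  + by rewrite size_map -cardE.
  + by move=> _ /mapP[h _ ->]; rewrite -dlU.
  move=> _ i Ci; have [h [x Kx]] := QP i Ci; exists (L h).
    by apply/mapP; exists h; rewrite ?mem_enum.
  by exists ((Q h).1 + x *m (Q h).2).
apply: (@crossed_by_seq _ _ _ _ _ (flatten [seq X j | j <- enum 'I_d.+1])).
- apply: size_flatten_le => j; have [sX _ _] := XP j.
  by apply: leq_trans sX _; exact: (leq_bigmax l).
- by move=> L /flatten_mapP[j _]; have [_ + _] := XP j; apply.
move=> L [j /= jk CL]; have [i KiL] := Kr L (Cr _ _ CL).
have [_ _ /(_ _ i)[||M MX KM]] := XP (s j).
- by rewrite sP.
- by apply/asboolP; rewrite KiL.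
exists M; last by rewrite -KiL.
by apply/flatten_mapP; exists (s j); rewrite ?mem_enum.
Qed.

Theorem theorem8 (R : realType) :
  exists f g : nat -> nat -> nat,
  forall (d : nat) (F : set (set 'rV[R]_d)) (C : 'I_d.+1 -> set (set 'rV[R]_d)),
    (1 <= d)%N ->
    finite_set F ->
    convex_family F ->
    colored F C ->
    (forall i, C i !=set0) ->
    colorful_helly C ->
    exists (k : nat) (s : 'S_d.+1),
      [/\ (1 <= k <= d)%N,
          pierced_by_points (f k d)
            (\bigcup_(j in [set j : 'I_d.+1 | (j < k)%N]) C (s j)) &
          crossed_by_flats (g k d) k
            (\bigcup_(j in [set j : 'I_d.+1 | (k <= j)%N]) C (s j))].
Proof.
have /choice[fg fgP] : forall d, exists fg : nat * nat, (0 < d)%N ->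
  forall (F : set (set 'rV[R]_d)) (C : 'I_d.+1 -> set (set 'rV[R]_d)),
    finite_set F -> convex_family F -> colored F C -> (forall i, C i !=set0) ->
    colorful_helly C ->
    exists (k : nat) (s : 'S_d.+1),
      [/\ (1 <= k <= d)%N,
          pierced_by_points fg.1 (\bigcup_(j in [set j : 'I_d.+1 | (j < k)%N]) C (s j)) &
          crossed_by_flats fg.2 k (\bigcup_(j in [set j : 'I_d.+1 | (k <= j)%N]) C (s j))].
  case=> [|d]; first by exists (0%N, 0%N).
  have [f [g fgP]] := @pierced_or_crossed_by_flats R d.+1 isT.
  by exists (f, g) => _; exact: fgP.
(* The bounds found for [d] serve every [k] at once. *)
exists (fun _ d => (fg d).1), (fun _ d => (fg d).2) => d F C d0.
exact: fgP d d0 F C.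
Qed.
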